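(* Let $R_1$ and $R_2$ be finite sets of non-negative integers with $R_1\cap R_2=\emptyset$, and let $R=R_1\cup R_2$. If $\alpha_1$ is not a strong jump for $R_1$ and $\alpha_2$ is not a strong jump for $R_2$, then $\alpha_1+\alpha_2$ is not a strong jump for $R$.
   Context: A hypergraph is a pair $H=(V,E)$ with $E\subseteq 2^V$; for a finite set $R$ of non-negative integers, $H$ is an $R$-graph if $|e|\in R$ for every $e\in E$. For an $R$-graph $H$ on $n$ vertices, its Lubell value is $h_n(H)=\sum_{e\in E(H)} 1/\binom{n}{|e|}$. A value $\alpha\in[0,|R|]$ is a strong jump for $R$ if there exists $c>0$ such that for every integer $t\ge \max R$ there is $n_0$ such that whenever $n\ge n_0$ and $G_n$ is an $R$-graph on $n$ vertices with $h_n(G_n)\ge \alpha-c$, $G_n$ contains a subgraph $H_t$ on $t$ vertices with $h_t(H_t)\ge \alpha+c$. *)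

(* Defs.v *)
From HB Require Import structures.
From mathcomp Require Import all_boot all_order all_algebra.
From mathcomp Require Import finmap.
From mathcomp Require Import reals.

Set Implicit Arguments.
Unset Strict Implicit.
Unset Printing Implicit Defensive.

Import Order.TTheory GRing.Theory Num.Theory.
Local Open Scope fset_scope.
Local Open Scope ring_scope.

(* The vertex set is a subset of an ambient finite type [T], so that a
   hypergraph and its subgraphs live over the same type. *)
Record hypergraph (T : finType) := Hypergraph {
  vertices : {set T};
  edges : {set {set T}};
  edges_sub : edges \subset powerset vertices
}.

Definition is_Rgraph (R : {fset nat}) (T : finType) (G : hypergraph T) : Prop :=
  forall e : {set T}, e \in edges G -> #|e| \in R.

(* Not necessarily induced. *)
Definition subgraph (T : finType) (H G : hypergraph T) : Prop :=
  vertices H \subset vertices G /\ edges H \subset edges G.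

Definition lubell (K : realType) (T : finType) (G : hypergraph T) : K :=
  \sum_(e in edges G) ('C(#|vertices G|, #|e|)%:R)^-1.

(* By convention the maximum of the empty set is 0. *)
Definition fset_max (R : {fset nat}) : nat := (\max_(r <- R) r)%N.

(* The ambient condition 0 <= alpha <= #|` R| is not part of this predicate:
   otherwise every alpha out of range would count as "not a strong jump". *)
Definition strong_jump (K : realType) (R : {fset nat}) (alpha : K) : Prop :=
  exists2 c : K, 0 < c &
    forall t : nat, (fset_max R <= t)%N ->
      exists n0 : nat, forall n : nat, (n0 <= n)%N ->
        forall (T : finType) (G : hypergraph T),
          is_Rgraph R G -> #|vertices G| = n -> alpha - c <= lubell K G ->
          exists H : hypergraph T,
            [/\ subgraph H G, #|vertices H| = t & alpha + c <= lubell K H].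

(* Main.v *)
Require Import Defs.
From mathcomp Require Import all_boot all_order all_algebra.
From mathcomp Require Import finmap.
From mathcomp Require Import boolp reals.
From mathcomp Require Import ring lra.

(** The Lubell value of [G] is the average of the Lubell values of its induced
    subgraphs on [m] vertices, for any [m] bounding the edge sizes. Averaging
    down, a non-jump yields for every large [n] an [n]-vertex graph of value at
    least [alpha - c], all of whose subgraphs on at least [t] vertices have value
    below [alpha + c]. Two such graphs for [R1] and [R2], overlaid on one vertex
    set, share no edge, so Lubell values add both for the overlay and for its
    subgraphs. *)

Set Implicit Arguments.
Unset Strict Implicit.
Unset Printing Implicit Defensive.

Import Order.TTheory GRing.Theory Num.Theory.
Local Open Scope fset_scope.
Local Open Scope ring_scope.

(** * Averaging and counting of finite sets *)

Lemma exists_le_average (K : realDomainType) (I : finType) (D : {set I})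
    (f : I -> K) (a : K) :
  D != set0 -> \sum_(i in D) f i = #|D|%:R * a ->
  exists2 i, i \in D & a <= f i.
Proof.
case/set0Pn => i0 Di0 sumf; apply/exists_inP; apply: contraT.
rewrite negb_exists_in => /forall_inP lt_fa.
have: \sum_(i in D) f i < \sum_(i in D) a.
  apply: ltr_sum => [|i Di]; last by rewrite ltNge lt_fa.
  by apply/hasP; exists i0; rewrite ?mem_index_enum.
by rewrite sumf sumr_const mulr_natl ltxx.
Qed.

(** Adding [e] is a bijection from the subsets of [V :\: e] of size [m - #|e|] onto the sets counted
    here, with inverse [S :\: e]. *)
Lemma card_supersets_draws (T : finType) (e V : {set T}) (m : nat) :
  e \subset V -> (#|e| <= m)%N ->
  #|[set S : {set T} | [&& S \subset V, #|S| == m & e \subset S]]| =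
    'C(#|V| - #|e|, m - #|e|).
Proof.
move=> eV em; rewrite -(setIidPr eV) -cardsD (setIidPr eV) -cards_draws.
rewrite -[RHS](@card_in_imset _ _ (fun A => e :|: A)) => [|A B].
  apply: eq_card => S; rewrite [LHS]inE; apply/idP/imsetP => [/and3P[SV /eqP Sm eS]|].
    exists (S :\: e); last by rewrite -{1}(setID S e) (setIidPr eS).
    by rewrite inE setSD //= cardsD (setIidPr eS) Sm.
  case=> A; rewrite inE subsetD => /andP[/andP[AV Ae] /eqP Am] ->.
  rewrite subUset eV AV subsetUl andbT /= cardsU setIC.
  by rewrite (disjoint_setI0 Ae) cards0 subn0 Am subnKC ?eqxx.
rewrite !inE !subsetD => /andP[/andP[_ Ae] _] /andP[/andP[_ Be] _] eqAB.
have cut (C : {set T}) : [disjoint C & e]%B -> (e :|: C) :\: e = C.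
  by move=> Ce; rewrite setDUl setDv set0U; apply/setDidPl.
by rewrite -(cut A Ae) eqAB cut.
Qed.

(** Both sides count the chains of an [r]-set inside an [m]-set inside an [N]-set. The proof clears
    the factorial denominators instead. *)
Lemma mul_bin_comm (N m r : nat) : (r <= m)%N -> (m <= N)%N ->
  ('C(N, m) * 'C(m, r) = 'C(N, r) * 'C(N - r, m - r))%N.
Proof.
move=> rm mN; have rN := leq_trans rm mN.
have mrNr : (m - r <= N - r)%N by rewrite leq_sub2r.
apply/eqP; rewrite -(@eqn_pmul2r (m`! * (N - m)`! * (r`! * (m - r)`!))); last first.
  by rewrite !muln_gt0 !fact_gt0.
apply/eqP.
have E1 := bin_fact mN; have E2 := bin_fact rm; have E3 := bin_fact rN.
have E4 := bin_fact mrNr; rewrite subnBA // subnK // in E4.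
transitivity (N`! * m`!)%N.
  by rewrite mulnACA E1 E2.
rewrite -E3 -E4 -!mulnA; congr (_ * _)%N.
by rewrite mulnCA; congr (_ * _)%N; ring.
Qed.

Section Hypergraphs.
Variable K : realType.

(** * Subgraphs and averaging of the Lubell value *)

Lemma edge_subset (T : finType) (G : hypergraph T) (e : {set T}) :
  e \in edges G -> e \subset vertices G.
Proof. by move=> eG; move/subsetP: (edges_sub G) => /(_ _ eG); rewrite inE. Qed.

Fact filter_edges_sub (T : finType) (G : hypergraph T) (p : pred {set T}) :
  [set e in edges G | p e] \subset powerset (vertices G).
Proof.
apply: subset_trans (edges_sub G); by apply/subsetP => e; rewrite inE => /andP[].
Qed.

(** All vertices are kept, so the remaining edges keep their weights. *)
Definition filter_edges (T : finType) (G : hypergraph T) (p : pred {set T}) :=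
  Hypergraph (filter_edges_sub G p).

Fact induced_sub (T : finType) (G : hypergraph T) (S : {set T}) :
  [set e in edges G | e \subset S] \subset powerset S.
Proof. by apply/subsetP => e; rewrite !inE => /andP[]. Qed.

Definition induced (T : finType) (G : hypergraph T) (S : {set T}) :=
  Hypergraph (induced_sub G S).

Lemma subgraph_trans (T : finType) (F G H : hypergraph T) :
  subgraph F G -> subgraph G H -> subgraph F H.
Proof.
by move=> [vFG eFG] [vGH eGH]; split; [apply: subset_trans vGH | apply: subset_trans eGH].
Qed.

Lemma subgraph_induced (T : finType) (G : hypergraph T) (S : {set T}) :
  S \subset vertices G -> subgraph (induced G S) G.
Proof. by move=> SV; split=> //; apply/subsetP => e; rewrite inE => /andP[]. Qed.

Lemma subgraph_Rgraph (R : {fset nat}) (T : finType) (H G : hypergraph T) :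
  subgraph H G -> is_Rgraph R G -> is_Rgraph R H.
Proof. by move=> [_ /subsetP sE] RG e /sE/RG. Qed.

Lemma Rgraph_card_le (R : {fset nat}) (T : finType) (G : hypergraph T) e :
  is_Rgraph R G -> e \in edges G -> (#|e| <= fset_max R)%N.
Proof. by move=> RG /RG eR; rewrite /fset_max (@leq_bigmax_seq _ (enum_fset R) xpredT id). Qed.

(** Double counting: an edge [e] lies in ['C(#|vertices G| - #|e|, m - #|e|)] of the sets [S] and
    weighs the inverse of ['C(m, #|e|)] in each; [mul_bin_comm] evaluates the product. *)
Lemma sum_lubell_induced (R : {fset nat}) (T : finType) (G : hypergraph T) m :
  is_Rgraph R G -> (fset_max R <= m)%N -> (m <= #|vertices G|)%N ->
  \sum_(S in [set S : {set T} | S \subset vertices G & #|S| == m])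
     lubell K (induced G S) = 'C(#|vertices G|, m)%:R * lubell K G.
Proof.
move=> RG Rm mN; rewrite /lubell /=.
under eq_bigr => S /[!inE] /andP[_ /eqP ->].
  under eq_bigl => e do rewrite inE.
  over.
rewrite (exchange_big_dep (mem (edges G))) /=; last by move=> S e _ /andP[].
rewrite mulr_sumr; apply: eq_bigr => e eG.
have em := leq_trans (Rgraph_card_le RG eG) Rm.
have eV := edge_subset eG.
rewrite sumr_const.
rewrite [X in _ *+ X](_ : _ = 'C(#|vertices G| - #|e|, m - #|e|)); last first.
  rewrite -card_supersets_draws //; apply: eq_card => S.
  by rewrite !inE unfold_in /= !inE eG /= -andbA.
(* Cross-multiplication needs nonzero denominators; here the bound of [m] on edge sizes enters. *)
have b1 : ('C(m, #|e|)%:R : K) != 0 by rewrite pnatr_eq0 -lt0n bin_gt0.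
have b2 : ('C(#|vertices G|, #|e|)%:R : K) != 0.
  by rewrite pnatr_eq0 -lt0n bin_gt0 subset_leq_card.
rewrite -[LHS]mulr_natl; apply/eqP; rewrite eqr_div // -!natrM.
by rewrite (mul_bin_comm em mN) mulnC.
Qed.

Lemma exists_dense_induced (R : {fset nat}) (T : finType) (G : hypergraph T) m :
  is_Rgraph R G -> (fset_max R <= m)%N -> (m <= #|vertices G|)%N ->
  exists S : {set T},
    [/\ S \subset vertices G, #|S| = m & lubell K G <= lubell K (induced G S)].
Proof.
move=> RG Rm mN.
have := sum_lubell_induced RG Rm mN; rewrite -cards_draws => /exists_le_average[|S].
  by rewrite -card_gt0 cards_draws bin_gt0.
by rewrite inE => /andP[SV /eqP Sm] le; exists S.
Qed.

(** * Transport along an injection of vertex types *)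

Section Relabel.
Variables (T U : finType) (f : T -> U).
Hypothesis f_inj : injective f.

Fact relabel_sub (H : hypergraph T) :
  [set f @: e | e : {set T} in edges H] \subset powerset (f @: vertices H).
Proof.
apply/subsetP => _ /imsetP[e eH ->]; rewrite inE imsetS //.
exact: edge_subset.
Qed.

Definition relabel (H : hypergraph T) := Hypergraph (relabel_sub H).

Lemma lubell_relabel (H : hypergraph T) : lubell K (relabel H) = lubell K H.
Proof.
rewrite /lubell /= big_imset => [|A B _ _]; last exact: imset_inj.
by apply: eq_bigr => e _; rewrite !card_imset.
Qed.

Fact pullback_sub (G : hypergraph U) :
  [set e : {set T} | f @: e \in edges G] \subset powerset (f @^-1: vertices G).
Proof.
apply/subsetP => e; rewrite !inE => eG; rewrite -sub_imset_pre.
exact: edge_subset.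
Qed.

(** Graphs witnessing a non-jump live on arbitrary finite types; pulling them back to ['I_n] gives
    two of them a common vertex type, as an overlay requires. *)
Definition pullback (G : hypergraph U) := Hypergraph (pullback_sub G).

Lemma subgraph_relabel_pullback (H : hypergraph T) (G : hypergraph U) :
  subgraph H (pullback G) -> subgraph (relabel H) G.
Proof.
move=> [/= vH /subsetP eH]; split=> /=; first by rewrite sub_imset_pre.
by apply/subsetP => _ /imsetP[e /eH + ->]; rewrite inE.
Qed.

Lemma pullback_Rgraph (R : {fset nat}) (G : hypergraph U) :
  is_Rgraph R G -> is_Rgraph R (pullback G).
Proof. by move=> RG e; rewrite inE => /RG; rewrite card_imset. Qed.

(** Since [f] covers the vertices, each edge is the image of its preimage, so relabelling the
    pullback restores the edges of [G]. *)
Lemma lubell_pullback (G : hypergraph U) :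
  vertices G = f @: setT -> lubell K (pullback G) = lubell K G.
Proof.
move=> vG; rewrite -lubell_relabel /lubell /=.
have -> : f @^-1: vertices G = setT by apply/setP => x; rewrite vG !inE imset_f.
rewrite -vG; apply: eq_bigl => e; apply/imsetP/idP => [[e' + ->]|eG]; first by rewrite inE.
have eA : e = f @: (f @^-1: e).
  apply/setP => y; apply/idP/imsetP => [ye|[x + ->]]; last by rewrite inE.
  move/subsetP: (edge_subset eG) => /(_ _ ye); rewrite vG => /imsetP[x _ y_fx].
  by exists x => //; rewrite inE -y_fx.
by exists (f @^-1: e) => //; rewrite inE -eA.
Qed.

End Relabel.

Lemma not_strong_jump_graphs (R : {fset nat}) (alpha c : K) :
  ~ strong_jump R alpha -> 0 < c ->
  exists2 t : nat, (fset_max R <= t)%N &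
    forall n : nat, (t <= n)%N -> exists G : hypergraph 'I_n,
      [/\ vertices G = setT, is_Rgraph R G, alpha - c <= lubell K G &
          forall H, subgraph H G -> (t <= #|vertices H|)%N ->
            lubell K H < alpha + c].
Proof.
move=> njump c0; apply: contrapT => nograph; apply: njump; exists c => // t Rt.
apply: contrapT => nojump; apply: nograph; exists t => // n tn.
(* The target order [n] serves as the threshold [n0]: the failure of the jump then gives a dense
   graph on some [N >= n] vertices, which is averaged down to exactly [n]. *)
apply: contrapT => nograph; apply: nojump; exists n => N nN T G RG VN Gc.
apply: contrapT => noH; apply: nograph; rewrite -VN in nN.
have [S [SV Sn GS]] := exists_dense_induced RG (leq_trans Rt tn) nN.
pose f (i : 'I_n) : T := enum_val (cast_ord (esym Sn) i).
have f_inj : injective f by move=> i j /enum_val_inj/cast_ord_inj.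
have fS : S = f @: setT.
  apply/esym/eqP; rewrite eqEcard card_imset // cardsT card_ord Sn leqnn andbT.
  by apply/subsetP => _ /imsetP[i _ ->]; apply: enum_valP.
have sSG := subgraph_induced SV.
have RS := subgraph_Rgraph sSG RG.
exists (pullback f (induced G S)); split.
- by apply/setP => i; rewrite !inE fS imset_f.
- exact: pullback_Rgraph.
- by rewrite lubell_pullback // (le_trans Gc).
move=> H sH tH; rewrite ltNge; apply/negP => le.
have RH := subgraph_Rgraph sH (pullback_Rgraph f_inj RS).
(* The failure of the jump only excludes subgraphs on exactly [t] vertices; averaging [H] down to
   [t] excludes the larger ones too. *)
have [A [AV At HA]] := exists_dense_induced RH Rt tH.
apply: noH; exists (relabel f (induced H A)); split.
- apply: subgraph_trans sSG; apply: subgraph_relabel_pullback.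
  exact: subgraph_trans (subgraph_induced AV) sH.
- by rewrite card_imset.
- by rewrite lubell_relabel // (le_trans le).
Qed.

(** * Overlaying two graphs and splitting one *)

Fact overlay_sub (T : finType) (G1 G2 : hypergraph T) :
  edges G1 :|: edges G2 \subset powerset (vertices G1 :|: vertices G2).
Proof.
rewrite subUset; apply/andP; split; apply: subset_trans (edges_sub _) _.
  by rewrite powersetS subsetUl.
by rewrite powersetS subsetUr.
Qed.

Definition overlay (T : finType) (G1 G2 : hypergraph T) :=
  Hypergraph (overlay_sub G1 G2).

Lemma lubell_overlay (T : finType) (G1 G2 : hypergraph T) :
  vertices G1 = vertices G2 -> [disjoint edges G1 & edges G2]%B ->
  lubell K (overlay G1 G2) = lubell K G1 + lubell K G2.
Proof.
move=> V12 dE; rewrite /lubell /= V12 setUid -bigU //=.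
by apply: eq_bigl => e; rewrite !inE.
Qed.

Lemma lubell_filterID (T : finType) (H : hypergraph T) (p : pred {set T}) :
  lubell K H = lubell K (filter_edges H p) + lubell K (filter_edges H (predC p)).
Proof.
rewrite /lubell /= (bigID p) /=.
by congr (_ + _); apply: eq_bigl => e; rewrite inE.
Qed.

End Hypergraphs.

Theorem theorem1 (K : realType) (R1 R2 : {fset nat}) (alpha1 alpha2 : K)
    (disjR : R1 `&` R2 = fset0)
    (range1 : 0 <= alpha1 <= (#|` R1|)%:R)
    (range2 : 0 <= alpha2 <= (#|` R2|)%:R)
    (notjump1 : ~ strong_jump R1 alpha1)
    (notjump2 : ~ strong_jump R2 alpha2) :
  ~ strong_jump (R1 `|` R2) (alpha1 + alpha2).
Proof.
(* Each factor gets half of [c], so that the two errors add up to [c]. *)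
case=> c c0 jump; have c20 : 0 < c / 2 by lra.
have [t1 Rt1 graph1] := not_strong_jump_graphs notjump1 c20.
have [t2 Rt2 graph2] := not_strong_jump_graphs notjump2 c20.
(* The maximum bounds all edge sizes, and a subgraph of this order is large enough for the upper
   bounds of both graphs. *)
have [|n0 jumpn] := jump (maxn t1 t2).
  apply/bigmax_leqP_seq => r + _; rewrite in_fsetU => /orP[] rR.
    apply: leq_trans (leq_maxl _ _); apply: leq_trans Rt1.
    exact: (@leq_bigmax_seq _ (enum_fset R1) xpredT id).
  apply: leq_trans (leq_maxr _ _); apply: leq_trans Rt2.
  exact: (@leq_bigmax_seq _ (enum_fset R2) xpredT id).
pose n := maxn n0 (maxn t1 t2).
have t1n : (t1 <= n)%N by rewrite /n !leq_max leqnn orbT.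
have t2n : (t2 <= n)%N by rewrite /n !leq_max leqnn !orbT.
have [G1 [V1 RG1 L1 small1]] := graph1 n t1n.
have [G2 [V2 RG2 L2 small2]] := graph2 n t2n.
have notR (e : {set 'I_n}) : #|e| \in R1 -> #|e| \in R2 -> False.
  by move=> e1 e2; have := in_fset0 #|e|; rewrite -disjR in_fsetI e1 e2.
have VG : vertices (overlay G1 G2) = setT by rewrite /= V1 setTU.
have [| | |H [sH Ht LH]] := jumpn n (leq_maxl _ _) _ (overlay G1 G2).
- move=> e; rewrite !inE => /orP[/RG1|/RG2] ->; by rewrite ?orbT.
- by rewrite VG cardsT card_ord.
- rewrite [lubell _ _](_ : _ = lubell K G1 + lubell K G2); first by lra.
  (* A common edge would have its size in both [R1] and [R2]. *)
  apply: lubell_overlay; rewrite ?V1 ?V2 // -setI_eq0.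
  apply/eqP/setP => e; rewrite !inE.
  by apply/negP => /andP[/RG1 e1 /RG2]; apply: notR.
(* Edge size alone tells which of [G1] and [G2] an edge of [H] comes from. *)
move: LH; rewrite (lubell_filterID K H (fun e => #|e| \in R1)).
set H1 := filter_edges H _; set H2 := filter_edges H _.
case: sH => _ /subsetP sH.
have sH1 : subgraph H1 G1.
  split; first by rewrite V1 subsetT.
  apply/subsetP => e; rewrite inE => /andP[/sH]; rewrite inE.
  by case/orP => // /RG2 e2 e1; case: (notR e).
have sH2 : subgraph H2 G2.
  split; first by rewrite V2 subsetT.
  apply/subsetP => e; rewrite inE => /andP[/sH]; rewrite !inE.
  by case/orP => // /RG1 ->.
have lt1 : lubell K H1 < alpha1 + c / 2 by rewrite small1 //= Ht leq_maxl.
have lt2 : lubell K H2 < alpha2 + c / 2 by rewrite small2 //= Ht leq_maxr.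
by rewrite leNgt => /negP[]; lra.
Qed.
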